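(* Let $G$ be a graph and let $t$ be an integer with $0\le t \leq \chi(G)-1$. Then $\Sigma_{\chi_{sym}^t}(G)= \{t+2, t+4,\dots,t+2k\}$, where $t+2 = m_{\chi_{sym}^t}(G)$ and $t+2k=M_{\chi_{sym}^t}(G)$; that is, the symset $t$-chromatic spectrum consists of all integers of the same parity as $t$ from $t+2$ up to its maximum $M_{\chi_{sym}^t}(G)$.
   Context: Graphs are finite multigraphs without loops (parallel edges allowed); $\chi(G)$ is the ordinary chromatic number. A signed graph $(G,\sigma)$ is a graph $G$ with a signature $\sigma:E(G)\to\{+,-\}$. A symmetric set is a set $S$ with an involution $s\mapsto -s$ on $S$; $s$ is self-inverse if $s=-s$. $S_{2k}^t$ ($t,k\ge 0$) is the symmetric set with exactly $t$ self-inverse elements $0_1,\dots,0_t$ and $2k$ non-self-inverse elements $\pm s_1,\dots,\pm s_k$. A proper $S_{2k}^t$-coloring of $(G,\sigma)$ is a map $c:V(G)\to S_{2k}^t$ with $c(v)\ne\sigma(e)c(w)$ for every edge $e=vw$. For $t\in\{0,\dots,\chi(G)\}$, the symset $t$-chromatic number $\chi_{sym}^t(G,\sigma)$ is the minimum of $t+2k$ over all $k\ge0$ for which $(G,\sigma)$ has a proper $S_{2k}^t$-coloring. The symset $t$-chromatic spectrum of $G$ is $\Sigma_{\chi_{sym}^t}(G)=\{\chi_{sym}^t(G,\sigma):\sigma \text{ a signature of } G\}$ (it suffices to take $\sigma$ up to switching equivalence, as equivalent signatures have the same $\chi^t_{sym}$); $m_{\chi_{sym}^t}(G)$ and $M_{\chi_{sym}^t}(G)$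 are its minimum and maximum. *)

(* Defs.v *)
From mathcomp Require Import all_boot.

Set Implicit Arguments.
Unset Strict Implicit.
Unset Printing Implicit Defensive.

(* Loopless finite multigraph: every edge has a set of exactly two ends, and
   distinct edges may have the same ends. *)
Record multigraph := Multigraph {
  vertex : finType;
  edge : finType;
  ends : edge -> {set vertex};
  card_ends : forall e, #|ends e| = 2 }.

Definition proper_vcoloring (G : multigraph) (n : nat)
    (c : {ffun vertex G -> 'I_n}) : bool :=
  [forall e : edge G, forall v, forall w,
     (ends e == [set v; w]) ==> (c v != c w)].

Definition vcolorable (G : multigraph) (n : nat) : bool :=
  [exists c : {ffun vertex G -> 'I_n}, proper_vcoloring c].

Lemma ends_neq (G : multigraph) (e : edge G) v w :
  ends e = [set v; w] -> v != w.
Proof. by move=> def_e; have := card_ends e; rewrite def_e cards2; case: eqP. Qed.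

Lemma ex_vcolorable (G : multigraph) : exists n, vcolorable G n.
Proof.
exists #|vertex G|; apply/existsP; exists [ffun v => enum_rank v].
apply/forallP=> e; apply/forallP=> v; apply/forallP=> w; apply/implyP.
by move=> /eqP/ends_neq; rewrite !ffunE (inj_eq enum_rank_inj).
Qed.

Definition chromatic_number (G : multigraph) : nat := ex_minn (ex_vcolorable G).

(* Signatures: [true] is the sign -, [false] is the sign +. *)
Definition signature (G : multigraph) : predArgType := {ffun edge G -> bool}.

Record symset := Symset {
  symset_sort :> finType;
  sopp : symset_sort -> symset_sort;
  soppK : involutive sopp }.

Definition sign_act (S : symset) (b : bool) (s : S) : S :=
  if b then sopp s else s.

Definition self_inverse (S : symset) (s : S) : bool := s == sopp s.

(* The symmetric set S_{2k}^t: [inl i] is the self-inverse element 0_i, and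
   [inr (j, false)], [inr (j, true)] are s_j and -s_j. *)
Definition std_opp (t k : nat) (s : 'I_t + 'I_k * bool) : 'I_t + 'I_k * bool :=
  match s with
  | inl i => inl i
  | inr (j, b) => inr (j, ~~ b)
  end.

Lemma std_oppK t k : involutive (@std_opp t k).
Proof. by case=> [//|[j b]] /=; rewrite negbK. Qed.

Definition std_symset (t k : nat) : symset := Symset (@std_oppK t k).

Lemma card_self_inverse t k : #|[set s : std_symset t k | self_inverse s]| = t.
Proof.
rewrite -[RHS]card_ord -(card_imset predT (inl_inj (B := 'I_k * bool))).
apply: eq_card => s; rewrite inE /self_inverse; apply/eqP/imsetP.
  by case: s => [i _|[j []] //]; exists i.
by case=> i _ ->.
Qed.

Lemma card_std_symset t k : #|std_symset t k| = t + 2 * k.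
Proof. by rewrite card_sum card_prod !card_ord card_bool mulnC. Qed.

Definition proper_scoloring (G : multigraph) (sigma : signature G) (S : symset)
    (c : {ffun vertex G -> S}) : bool :=
  [forall e : edge G, forall v, forall w,
     (ends e == [set v; w]) ==> (c v != sign_act (sigma e) (c w))].

Definition scolorable (G : multigraph) (sigma : signature G) (S : symset) : bool :=
  [exists c : {ffun vertex G -> S}, proper_scoloring sigma c].

Lemma scolorable_card (G : multigraph) (sigma : signature G) (t : nat) :
  scolorable sigma (std_symset t #|vertex G|).
Proof.
apply/existsP; exists [ffun v => inr (enum_rank v, false)].
apply/forallP=> e; apply/forallP=> v; apply/forallP=> w; apply/implyP.
move=> /eqP/ends_neq neq_vw; rewrite !ffunE; apply: contraNneq neq_vw.
by case: (sigma e) => //= -[/enum_rank_inj ->].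
Qed.

Lemma ex_scolorable (G : multigraph) (sigma : signature G) (t : nat) :
  exists k, scolorable sigma (std_symset t k).
Proof. by exists #|vertex G|; apply: scolorable_card. Qed.

(* The minimum of t + 2 k is attained at the least admissible k. *)
Definition chi_sym (G : multigraph) (t : nat) (sigma : signature G) : nat :=
  t + 2 * ex_minn (ex_scolorable sigma t).

Definition spectrum (G : multigraph) (t : nat) : pred nat :=
  [pred n | [exists sigma : signature G, chi_sym t sigma == n]].

Lemma ex_spectrum (G : multigraph) (t : nat) : exists n, spectrum G t n.
Proof.
pose sigma : signature G := [ffun=> false].
by exists (chi_sym t sigma); apply/existsP; exists sigma.
Qed.

Lemma spectrum_bounded (G : multigraph) (t n : nat) :
  spectrum G t n -> n <= t + 2 * #|vertex G|.
Proof.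
case/existsP=> sigma /eqP <-; rewrite leq_add2l leq_pmul2l //.
by case: ex_minnP => k _; apply; apply: scolorable_card.
Qed.

Definition min_spectrum (G : multigraph) (t : nat) : nat :=
  ex_minn (ex_spectrum G t).

Definition max_spectrum (G : multigraph) (t : nat) : nat :=
  ex_maxn (ex_spectrum G t) (@spectrum_bounded G t).

(* Main.v *)
Require Import Defs.
From mathcomp Require Import all_boot.

(** The all-negative signature is coloured by the single colour [s_1], so the
    least [k] is at most 1 there, and [t < chi(G)] forbids [k = 0].  Changing
    the sign of one edge raises the least [k] by at most 1, since one end of
    that edge can be recoloured with a new pair [s], [-s].  Changing signs edge by
    edge, from the all-negative signature to one attaining the maximum,
    therefore meets every intermediate value. *)

Definition pair_rank {G : multigraph} (t : nat) (sigma : signature G) : nat :=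
  ex_minn (ex_scolorable sigma t).

(** Only upward steps need a bound, since [f] may drop freely: if [f n < m <= f n.+1], then the
    bound forces [f n.+1 = m]. *)
Lemma nat_discrete_ivt (f : nat -> nat) n m :
  (forall i, f i.+1 <= (f i).+1) -> f 0 <= m <= f n -> exists i, f i = m.
Proof.
move=> f_step /andP[le_f0m]; elim: n => [|n IHn] le_mfn.
  by exists 0; apply/eqP; rewrite eqn_leq le_f0m.
have [/IHn // | lt_fnm] := leqP m (f n).
by exists n.+1; apply/eqP; rewrite eqn_leq le_mfn (leq_trans (f_step n)).
Qed.

Lemma scolorableP {G : multigraph} {sigma : signature G} {S : symset} :
  reflect (exists c : vertex G -> S, forall e v w,
             ends e = [set v; w] -> c v <> sign_act (sigma e) (c w))
          (scolorable sigma S).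
Proof.
apply: (iffP existsP) => [[c /forallP c_ok] | [c c_ok]].
  exists c => e v w /eqP def_e; apply/eqP.
  by have /forallP/(_ v)/forallP/(_ w)/implyP/(_ def_e) := c_ok e.
exists (finfun c); apply/forallP=> e; apply/forallP=> v; apply/forallP=> w.
by apply/implyP=> /eqP/c_ok/eqP; rewrite !ffunE.
Qed.

(** Without pairs every colour is self-inverse, so the signs act trivially and the colouring is an
    ordinary proper one. *)
Lemma scolorable_no_pair (G : multigraph) (sigma : signature G) t :
  scolorable sigma (std_symset t 0) -> vcolorable G t.
Proof.
case/scolorableP=> c c_ok.
have inl_c v : {i | c v = inl i} by case: (c v) => [i | [[]//]]; exists i.
apply/existsP; exists [ffun v => sval (inl_c v)].
apply/forallP=> e; apply/forallP=> v; apply/forallP=> w; apply/implyP.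
move=> /eqP/c_ok; rewrite !ffunE.
case: (inl_c v) (inl_c w) => [i /= ->] [j /= ->] neq_ij.
by apply/eqP=> eq_ij; apply: neq_ij; rewrite eq_ij; case: (sigma e).
Qed.

Lemma scolorable_negative (G : multigraph) t :
  scolorable ([ffun=> true] : signature G) (std_symset t 1).
Proof.
by apply/scolorableP; exists (fun=> inr (ord0, false)) => e v w _; rewrite ffunE.
Qed.

(** The shift by [lift ord_max] leaves the index [ord_max] free for a new pair. *)
Definition std_widen {t k} (s : std_symset t k) : std_symset t k.+1 :=
  match s with
  | inl i => inl i
  | inr (j, b) => inr (lift ord_max j, b)
  end.

Lemma std_widen_inj {t k} : injective (@std_widen t k).
Proof.
move=> [i|[i b]] [j|[j b']] //= /eqP; first by move/eqP=> [->].
by case/andP=> /eqP/lift_inj-> /eqP/= ->.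
Qed.

Lemma std_widen_sign_act t k b (s : std_symset t k) :
  std_widen (sign_act b s) = sign_act b (std_widen s).
Proof. by case: b s => [] [|[]]. Qed.

Lemma std_widen_new_pair t k (s : std_symset t k) a b :
  std_widen s <> sign_act b (inr (ord_max, a) : std_symset t k.+1).
Proof.
case: s b => [i|[j b']] [] //= eq_s; have /eqP/andP[/=] := eq_s;
  by rewrite eq_sym (negPf (neq_lift _ _)).
Qed.

Lemma sign_actK (S : symset) b : involutive (@sign_act S b).
Proof. by case: b => // s; apply: soppK. Qed.

(** Giving [u] a colour of the new pair settles all edges at [u], whatever their signs: their other
    ends keep old colours, as there are no loops. Edges avoiding [u] keep both their sign and their
    colours. *)
Lemma scolorable_change_at {G : multigraph} {sigma tau : signature G} {t k} u :
    (forall e, u \notin ends e -> tau e = sigma e) ->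
  scolorable sigma (std_symset t k) -> scolorable tau (std_symset t k.+1).
Proof.
move=> eq_tau /scolorableP[c c_ok]; apply/scolorableP.
exists (fun v => if v == u then inr (ord_max, false) else std_widen (c v)).
move=> e v w def_e; have neq_vw := ends_neq def_e.
case: (eqVneq v u) => [def_v | neq_vu]; case: (eqVneq w u) => [def_w | neq_wu].
- by rewrite def_v def_w eqxx in neq_vw.
(* Here the sign stands on the old colour; being an involution, it can be moved to the new one. *)
- move/(congr1 (sign_act (tau e))); rewrite sign_actK => /esym.
  exact: std_widen_new_pair.
- exact: std_widen_new_pair.
rewrite -std_widen_sign_act => /std_widen_inj; rewrite eq_tau; first exact: c_ok.
by rewrite def_e !inE negb_or !(eq_sym u) neq_vu.
Qed.

Lemma pair_rank_change_edge (G : multigraph) (sigma tau : signature G) t e0 :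
    (forall e, e != e0 -> tau e = sigma e) ->
  pair_rank t tau <= (pair_rank t sigma).+1.
Proof.
move=> eq_tau; rewrite /pair_rank.
case: ex_minnP => m _; apply; case: ex_minnP => k col_k _.
have /card_gt0P[u e0u] : 0 < #|ends e0| by rewrite card_ends.
apply: (scolorable_change_at u _ col_k) => e.
by move=> notin_u; apply: eq_tau; apply: contraNneq notin_u => ->.
Qed.

(** As [true] is the sign -, the implication makes every edge of rank at least [i] negative: index 0
    is all-negative and index [#|edge G|] is [sigma]. *)
Definition partial_signature {G : multigraph} (sigma : signature G) (i : nat) :
    signature G :=
  [ffun e => (enum_rank e < i) ==> sigma e].

Lemma pair_rank_partial_signatureS (G : multigraph) (sigma : signature G) t i :
  pair_rank t (partial_signature sigma i.+1)
    <= (pair_rank t (partial_signature sigma i)).+1.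
Proof.
have [lt_i | ge_i] := ltnP i #|edge G|.
  apply: (@pair_rank_change_edge _ _ _ _ (enum_val (Ordinal lt_i))) => e neq_e.
  rewrite !ffunE ltnS leq_eqVlt; case: eqP => // eq_i.
  by rewrite -(inj_eq enum_rank_inj) enum_valK -val_eqE /= eq_i eqxx in neq_e.
(* Past the last edge the sequence is constant, so the step bound holds for every [i]. *)
rewrite (_ : partial_signature sigma i.+1 = partial_signature sigma i) //.
apply/ffunP=> e; rewrite !ffunE.
by have lt_ei := leq_trans (ltn_ord (enum_rank e)) ge_i; rewrite lt_ei ltnW.
Qed.

Lemma pair_rank_gt0 (G : multigraph) (sigma : signature G) t :
  t < chromatic_number G -> 0 < pair_rank t sigma.
Proof.
rewrite /chromatic_number /pair_rank; case: ex_minnP => chi _ chi_min lt_t.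
case: ex_minnP => -[|//] /scolorable_no_pair/chi_min.
by rewrite leqNgt lt_t.
Qed.

Lemma pair_rank_negative (G : multigraph) t :
  pair_rank t ([ffun=> true] : signature G) <= 1.
Proof.
by rewrite /pair_rank; case: ex_minnP => k _; apply; apply: scolorable_negative.
Qed.

Lemma pair_rank_interval (G : multigraph) (sigma : signature G) t m :
  0 < m <= pair_rank t sigma -> exists tau : signature G, pair_rank t tau = m.
Proof.
case/andP=> m_gt0 le_m; pose f i := pair_rank t (partial_signature sigma i).
have f0 : f 0 <= m.
  apply: leq_trans m_gt0; rewrite /f; apply: leq_trans (pair_rank_negative G t).
  by apply/eq_leq; congr pair_rank; apply/ffunP=> e; rewrite !ffunE.
have fn : f #|edge G| = pair_rank t sigma.
  by congr pair_rank; apply/ffunP=> e; rewrite !ffunE ltn_ord.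
have [|i <-] := nat_discrete_ivt f #|edge G| m (pair_rank_partial_signatureS G sigma t).
  by rewrite f0 fn.
by exists (partial_signature sigma i).
Qed.

Lemma spectrumP {G : multigraph} {t n} :
  reflect (exists sigma : signature G, n = t + 2 * pair_rank t sigma)
          (spectrum G t n).
Proof.
by apply: (iffP existsP) => [[s /eqP<-] | [s ->]]; exists s.
Qed.

Theorem theorem2p15 (G : multigraph) (t : nat) (ht : t < chromatic_number G) :
  exists k : nat,
    [/\ t + 2 = min_spectrum G t,
        t + 2 * k = max_spectrum G t
      & forall n : nat,
          n \in spectrum G t <-> exists i : nat, 1 <= i <= k /\ n = t + 2 * i].
Proof.
rewrite /max_spectrum /min_spectrum.
case: ex_maxnP => _ /spectrumP[sigma ->] max_sigma.
have spec_interval i : 0 < i <= pair_rank t sigma -> spectrum G t (t + 2 * i).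
  by case/pair_rank_interval=> tau <-; apply/spectrumP; exists tau.
exists (pair_rank t sigma); split=> // [|n].
  case: ex_minnP => _ /spectrumP[tau ->] min_tau.
  (* One inequality is positivity of the rank of [tau]; the other holds because the rank 1 is
     attained. *)
  apply/eqP; rewrite eqn_leq (@leq_add2l t 2) -{1}[2]muln1 leq_pmul2l //.
  rewrite pair_rank_gt0 //=; apply: (min_tau (t + 2 * 1)).
  by rewrite spec_interval ?pair_rank_gt0.
split=> [spec_n | [i [/spec_interval spec_i ->]] //].
have /spectrumP[tau def_n] := spec_n; exists (pair_rank t tau); split=> //.
by have := max_sigma n spec_n; rewrite pair_rank_gt0 // def_n leq_add2l leq_pmul2l.
Qed.
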